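(* Let $r\ge0$ and $m,n>1$ be integers. Then \[\sum_{1\le k_m<\cdots<k_1\le n}\frac{1}{(k_1+r)\cdots(k_m+r)}=\sum_{\substack{i+j=m\\ i,j\ge0}}(-1)^i\,\zeta_r^\star(\{1\}_i)\,\zeta_{n+r}(\{1\}_j).\]
   Context: $\{1\}_q$ denotes $1$ repeated $q$ times. For a positive integer $N$, $\zeta_N(\{1\}_j)=\sum_{N\ge n_1>\cdots>n_j\ge1}\frac{1}{n_1\cdots n_j}$ and $\zeta_N^\star(\{1\}_i)=\sum_{N\ge n_1\ge\cdots\ge n_i\ge1}\frac{1}{n_1\cdots n_i}$, with $\zeta_N(\emptyset)=\zeta_N^\star(\emptyset)=1$ and $\zeta_N(\{1\}_j)=0$ if $N<j$. For $N=0$: $\zeta_0^\star(\emptyset)=\zeta_0(\emptyset)=1$ and $\zeta_0^\star(\{1\}_i)=\zeta_0(\{1\}_j)=0$ for $i,j\ge1$. *)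

(* Defs.v *)
From mathcomp Require Import all_boot all_order all_algebra.

Set Implicit Arguments.
Unset Strict Implicit.
Unset Printing Implicit Defensive.

Import GRing.Theory.
Local Open Scope ring_scope.

(* The summation indices N >= n_1, ..., n_j >= 1 are encoded as a j-tuple over
   'I_N = {0, ..., N - 1}, the element k standing for the index k + 1.  For
   N = 0 the only such tuple is the empty one, of weight 1. *)

Definition strictly_decreasing (N j : nat) (k : j.-tuple 'I_N) : bool :=
  sorted (fun a b : 'I_N => (b < a)%N) k.

Definition weakly_decreasing (N j : nat) (k : j.-tuple 'I_N) : bool :=
  sorted (fun a b : 'I_N => (b <= a)%N) k.

(* zeta_N({1}_j) *)
Definition zeta1 (N j : nat) : rat :=
  \sum_(k : j.-tuple 'I_N | strictly_decreasing k)
     \prod_(a <- k) (a.+1)%:R^-1.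

(* zeta_N^star({1}_i) *)
Definition zeta1_star (N i : nat) : rat :=
  \sum_(k : i.-tuple 'I_N | weakly_decreasing k)
     \prod_(a <- k) (a.+1)%:R^-1.

(* Main.v *)
(** Both kinds of sums satisfy first-order recurrences in the number of
    variables: the strict sums by splitting off the smallest variable,
    [e_{j+1}(w_0, ..., w_n) = e_{j+1}(w_1, ..., w_n) + w_0 e_j(w_1, ..., w_n)],
    the weak ones by splitting off the largest,
    [h_{i+1}(w_0, ..., w_r) = h_{i+1}(w_0, ..., w_{r-1}) + w_r h_i(w_0, ..., w_r)].
    For arbitrary weights [w], the identity then follows by induction on [r] and,
    for fixed [r], on [m]: passing from [r] to [r + 1] on either side divides the
    generating function in [m] by [1 + w_r t]. *)
Require Import Defs.
From mathcomp Require Import all_boot all_order all_algebra.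
From mathcomp Require Import ring.

Import GRing.Theory.
Local Open Scope ring_scope.

Section NestedSums.

Set Implicit Arguments.
Unset Strict Implicit.

Variable R : comPzRingType.
Implicit Types (w : nat -> R) (d : bool).

(* [d = false] gives the strictly and [d = true] the weakly decreasing sums:
   after the index [a], the next one ranges over the indices below [a + d]. *)
Fixpoint nested_sum d w (N j : nat) : R :=
  if j is j'.+1 then \sum_(a < N) w a * nested_sum d w (a + d) j' else 1.

Lemma nested_sumSS d w N j :
  nested_sum d w N.+1 j.+1 =
  nested_sum d w N j.+1 + w N * nested_sum d w (N + d) j.
Proof. by rewrite /= big_ord_recr. Qed.

Lemma nested_sum0S d w j : nested_sum d w 0 j.+1 = 0.
Proof. by rewrite /= big_ord0. Qed.

Lemma big_tuple_cons (T : finType) j (P : pred (seq T)) (F : seq T -> R) :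
  \sum_(k : j.+1.-tuple T | P k) F k =
  \sum_(a : T) \sum_(k : j.-tuple T | P (a :: k)) F (a :: k).
Proof.
rewrite pair_big_dep /=.
rewrite (reindex (fun p : T * j.-tuple T => [tuple of p.1 :: p.2])) //=.
exists (fun k => (thead k, [tuple of behead k])) => [[a k] _ | k _] /=.
  by rewrite theadE; congr (_, _); apply: val_inj.
by rewrite -tuple_eta.
Qed.

(** Fixing the preceding entry [a] makes induction on [j] possible: the first entry [b] ranges below
    [a + d] and becomes the new bound for the tail. *)
Lemma sum_path_nested d w N j (a : 'I_N) :
  \sum_(k : j.-tuple 'I_N | path (fun x y : 'I_N => (y < x + d)%N) a k)
     \prod_(x <- k) w x = nested_sum d w (a + d) j.
Proof.
elim: j a => [|j IHj] a.
  rewrite (big_pred1 [tuple]) ?big_nil // => k.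
  by rewrite (tuple0 k) /= eqxx.
rewrite (big_tuple_cons _ (path _ a) (fun s : seq 'I_N => \prod_(x <- s) w x)) /=.
(* As [a < N], the range below [a + d] fits in ['I_N] even for [d = true]. *)
have leN : (a + d <= N)%N by case: d {IHj}; rewrite ?addn1 ?addn0 // ltnW.
rewrite (big_ord_widen _ (fun b => w b * nested_sum d w (b + d) j) leN).
rewrite [RHS]big_mkcond; apply: eq_bigr => b _.
case: ifP => ltba /=; last by rewrite big_pred0.
by rewrite -IHj big_distrr; apply: eq_bigr => k _; rewrite big_cons.
Qed.

Lemma sum_sorted_nested d w N j :
  \sum_(k : j.-tuple 'I_N | sorted (fun x y : 'I_N => (y < x + d)%N) k)
     \prod_(x <- k) w x = nested_sum d w N j.
Proof.
case: j => [|j].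
  rewrite (big_pred1 [tuple]) ?big_nil // => k.
  by rewrite (tuple0 k) /= eqxx.
rewrite (big_tuple_cons _ (sorted _) (fun s : seq 'I_N => \prod_(x <- s) w x)) /=.
apply: eq_bigr => b _; rewrite -sum_path_nested big_distrr.
by apply: eq_bigr => k _; rewrite big_cons.
Qed.

(** [nested_sum] peels off the largest index; induction on [N] transfers this to the smallest, since
    the two splittings commute. *)
Lemma strict_sumSS_smallest w N j :
  nested_sum false w N.+1 j.+1 =
  nested_sum false (w \o succn) N j.+1 +
  w 0%N * nested_sum false (w \o succn) N j.
Proof.
elim: N j => [|N IHN] j.
  by rewrite nested_sumSS !nested_sum0S addn0; case: j => // j; rewrite !nested_sum0S.
rewrite nested_sumSS IHN [in RHS]nested_sumSS !addn0 /=.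
case: j => [|j] /=; first by ring.
rewrite -!/(nested_sum _ _ _ j.+1) IHN (nested_sumSS _ (w \o succn)) addn0 /=.
by ring.
Qed.

Lemma strict_sum_ext w w' N j :
  w =1 w' -> nested_sum false w N j = nested_sum false w' N j.
Proof.
move=> eqw; elim: j N => //= j IHj N.
by apply: eq_bigr => a _; rewrite eqw IHj.
Qed.

Lemma strict_sum_shift w r n m :
  nested_sum false (fun a => w (a + r)%N) n m =
  \sum_(i < m.+1)
     (-1) ^+ i * nested_sum true w r i * nested_sum false w (n + r) (m - i).
Proof.
elim: r n m => [|r IHr] n m.
  rewrite big_ord_recl big1 => [|i _]; last by rewrite nested_sum0S mulr0 mul0r.
  rewrite expr0 !mul1r addr0 addn0 subn0.
  by apply: strict_sum_ext => a; rewrite addn0.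
elim: m => [|m IHm]; first by rewrite big_ord1 /= !mulr1.
have := strict_sumSS_smallest (fun a => w (a + r)%N) n m.
rewrite IHr add0n.
have eqw: (fun a => w (a + r)%N) \o succn =1 (fun a => w (a + r.+1)%N).
  by move=> a /=; rewrite addSnnS.
rewrite !(strict_sum_ext _ _ eqw).
(* Solve for the sum shifted by [r.+1]; both remaining sums then involve the same [n + r.+1]
   weights. *)
move/esym/(canRL (addrK _)) ->; rewrite IHm addSnnS.
(* The terms at index 0 agree; the others match one by one through the weak recurrence at [w r]. *)
rewrite big_ord_recl [RHS]big_ord_recl /= -addrA; congr (_ + _).
rewrite mulr_sumr -sumrB; apply: eq_bigr => i _.
by rewrite -!/(nested_sum _ _ _ i.+1) nested_sumSS addn1 !exprS subSS; ring.
Qed.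

End NestedSums.

Lemma zeta1_nested N j : zeta1 N j = nested_sum false (fun a => a.+1%:R^-1) N j.
Proof.
rewrite -sum_sorted_nested; apply: eq_bigl => k.
by apply: eq_sorted => x y; rewrite addn0.
Qed.

Lemma zeta1_star_nested N i :
  zeta1_star N i = nested_sum true (fun a => a.+1%:R^-1) N i.
Proof.
rewrite -sum_sorted_nested; apply: eq_bigl => k.
by apply: eq_sorted => x y; rewrite addn1.
Qed.

Theorem theorem2p6 (r m n : nat) (hm : (1 < m)%N) (hn : (1 < n)%N) :
  \sum_(k : m.-tuple 'I_n | strictly_decreasing k)
     \prod_(a <- k) (a.+1 + r)%:R^-1
  = \sum_(i < m.+1) \sum_(j < m.+1 | (i + j == m)%N)
       (-1) ^+ i * zeta1_star r i * zeta1 (n + r) j :> rat.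
Proof.
transitivity (nested_sum false (fun a => (a + r).+1%:R^-1 : rat) n m).
  rewrite -sum_sorted_nested; apply: eq_bigl => k.
  by apply: eq_sorted => x y; rewrite addn0.
rewrite (strict_sum_shift (fun a => a.+1%:R^-1 : rat)); apply: eq_bigr => i _.
(* Only [j = m - i], the value of [rev_ord i], meets the constraint. *)
rewrite (big_pred1 (rev_ord i)) => [|j].
  by rewrite zeta1_star_nested zeta1_nested /= subSS.
apply/eqP/eqP => [ijm|->]; last by rewrite /= subSS subnKC // -ltnS.
by apply: val_inj; rewrite /= subSS -[X in (X - i)%N]ijm addKn.
Qed.
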